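(* Let $(M,J,g)$ be a $2n$-dimensional $\mathcal{W}_1$-manifold with Norden metric, with Levi-Civita connection $\nabla$, Lie 1-form $\theta$ and Lie vector $\Omega$. For all real numbers $\lambda_1,\dots,\lambda_8$, the linear connection $\nabla'$ defined by $\nabla'_x y=\nabla_x y+Q(x,y)$, where $$\begin{aligned}Q(x,y)={}&\tfrac{1}{2n}\left[\theta(Jy)x-g(x,y)J\Omega\right]+\tfrac1n\big\{\lambda_1\theta(x)y+\lambda_2\theta(x)Jy+\lambda_3\theta(Jx)y+\lambda_4\theta(Jx)Jy\\&+\lambda_5[\theta(y)x-\theta(Jy)Jx]+\lambda_6[\theta(y)Jx+\theta(Jy)x]\\&+\lambda_7[g(x,y)\Omega-g(x,Jy)J\Omega]+\lambda_8[g(x,Jy)\Omega+g(x,y)J\Omega]\big\},\end{aligned}$$ is a complex connection, i.e. $\nabla'J=0$. Thus these formulas define an eight-parametric family of complex connections on $M$.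
   Context: An almost complex manifold with Norden metric $(M,J,g)$ is a smooth $2n$-dimensional manifold with an almost complex structure $J$ ($J^2=-\mathrm{id}$) and a pseudo-Riemannian metric $g$ with $g(Jx,Jy)=-g(x,y)$ for all vector fields $x,y$. Let $\nabla$ be the Levi-Civita connection of $g$ and $F(x,y,z)=g((\nabla_xJ)y,z)$. The Lie 1-form is $\theta(x)=g^{ij}F(e_i,e_j,x)$ (for any local basis $\{e_i\}$, $(g^{ij})$ the inverse matrix of $g$), and the Lie vector $\Omega$ is defined by $\theta(x)=g(x,\Omega)$. $(M,J,g)$ is a $\mathcal{W}_1$-manifold if $$F(x,y,z)=\tfrac{1}{2n}\left[g(x,y)\theta(z)+g(x,Jy)\theta(Jz)+g(x,z)\theta(y)+g(x,Jz)\theta(Jy)\right].$$ A linear connection $\nabla'$ is (almost) complex if $\nabla'J=0$. *)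

(* Defs.v *)
From HB Require Import structures.
From mathcomp Require Import all_boot all_order all_algebra.
From mathcomp Require Import all_classical all_reals all_analysis.
From mathcomp Require Import ring.

Set Implicit Arguments.
Unset Strict Implicit.
Unset Printing Implicit Defensive.

Import Order.TTheory GRing.Theory Num.Theory.
Import numFieldNormedType.Exports.

Local Open Scope classical_set_scope.
Local Open Scope ring_scope.

Section SmoothOn.
Context {R : realType} {m : nat}.
Local Notation V := 'rV[R]_m.

(* [Ck k U f] is used for open [U] only, so that the values of [f] outside [U]
   are irrelevant. *)
Fixpoint Ck (k : nat) (U : set V) (f : V -> R) : Prop :=
  (forall x, U x -> {for x, continuous f}) /\
  if k is k'.+1 then
    forall i : 'I_m, let e := 'e_i : V in
      (forall x, U x -> derivable f x e) /\ Ck k' U (fun x => 'D_e f x)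
  else True.

Definition smooth_on (U : set V) (f : V -> R) : Prop := forall k, Ck k U f.

Lemma Ck_cont k (U : set V) f : Ck k U f -> forall x, U x -> {for x, continuous f}.
Proof. by case: k => [|k] []. Qed.

Lemma CkW k (U : set V) f : Ck k.+1 U f -> Ck k U f.
Proof.
elim: k f => [|k IHk] f [fc fd]; split => // i /=.
by have [? ?] := fd i; split => //; exact: IHk.
Qed.

Lemma eq_Ck k (U : set V) f h : open U -> (forall x, U x -> f x = h x) ->
  Ck k U f -> Ck k U h.
Proof.
move=> Uo; have nearU (f' h' : V -> R) x : (forall x, U x -> f' x = h' x) -> U x ->
    \forall y \near x, f' y = h' y.
  by move=> fh Ux; apply: filterS fh _; exact: open_nbhs_nbhs.
have cont (f' h' : V -> R) : (forall x, U x -> f' x = h' x) ->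
    (forall x, U x -> {for x, continuous f'}) ->
    (forall x, U x -> {for x, continuous h'}).
  move=> fh fc x Ux; rewrite /prop_for /continuous_at -(fh _ Ux).
  apply: cvg_trans (fc x Ux).
  exact: (near_eq_cvg (F := nbhs x) (nearU _ _ _ fh Ux)).
elim: k f h => [|k IHk] f h fh.
  by move=> [fc _]; split=> //; exact: cont fc.
move=> [fc fd]; split; first exact: cont fc.
move=> i /=; have [di ci] := fd i; split=> [x Ux|].
  by apply: near_eq_derivable (di x Ux); exact: nearU.
apply: IHk ci => x Ux; exact/near_eq_derive/nearU.
Qed.

Lemma Ck_cst k (U : set V) (c : R) : open U -> Ck k U (fun=> c).
Proof.
move=> Uo; elim: k c => [|k IHk] c; first by split=> // x _; exact: cst_continuous.
split=> [x _|i /=]; first exact: cst_continuous.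
split=> [x _|]; first exact: derivable_cst.
apply: (eq_Ck Uo _ (IHk 0)) => x _.
by rewrite derive_cst.
Qed.

Lemma CkD k (U : set V) f h : open U -> Ck k U f -> Ck k U h ->
  Ck k U (fun x => f x + h x).
Proof.
move=> Uo; elim: k f h => [|k IHk] f h [fc fd] [hc hd].
  by split=> // x Ux; apply: continuousD; [exact: fc|exact: hc].
split=> [x Ux|i /=]; first by apply: continuousD; [exact: fc|exact: hc].
have [df cf] := fd i; have [dh ch] := hd i; split=> [x Ux|].
  by apply: derivableD; [exact: df|exact: dh].
apply: (eq_Ck Uo _ (IHk _ _ cf ch)) => x Ux /=.
by rewrite -deriveD//; [exact: df|exact: dh].
Qed.

Lemma CkM k (U : set V) f h : open U -> Ck k U f -> Ck k U h ->
  Ck k U (fun x => f x * h x).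
Proof.
move=> Uo; elim: k f h => [|k IHk] f h cf ch.
  by split=> // x Ux; apply: continuousM; [exact: (Ck_cont cf)|exact: (Ck_cont ch)].
split=> [x Ux|i /=].
  by apply: continuousM; [exact: (Ck_cont cf)|exact: (Ck_cont ch)].
have [_ /(_ i) /= [df dcf]] := cf; have [_ /(_ i) /= [dh dch]] := ch.
split=> [x Ux|]; first by apply: derivableM; [exact: df|exact: dh].
have fk := CkW cf; have hk := CkW ch.
apply: (eq_Ck Uo _ (CkD Uo (IHk _ _ fk dch) (IHk _ _ hk dcf))) => x Ux /=.
by rewrite -[in RHS]/(f * h) deriveM//; [exact: df|exact: dh].
Qed.

End SmoothOn.

(* A chart is a homeomorphism from the open set [cdom] onto the open set [cimg];
   [cmap] and [cinv] are total functions whose values outside these sets are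
   irrelevant. *)
Record chart (R : realType) (m : nat) (T : topologicalType) := Chart {
  cdom : set T;
  cimg : set 'rV[R]_m;
  cmap : T -> 'rV[R]_m;
  cinv : 'rV[R]_m -> T;
  cdom_open : open cdom;
  cimg_open : open cimg;
  cmap_img : forall p, cdom p -> cimg (cmap p);
  cinv_dom : forall u, cimg u -> cdom (cinv u);
  cmapK : forall p, cdom p -> cinv (cmap p) = p;
  cinvK : forall u, cimg u -> cmap (cinv u) = u;
  cmap_cont : forall p, cdom p -> {for p, continuous cmap};
  cinv_cont : forall u, cimg u -> {for u, continuous cinv} }.

Record manifold (R : realType) (m : nat) := Manifold {
  mcarrier :> topologicalType;
  mhausdorff : hausdorff_space mcarrier;
  msecond_countable : @second_countable mcarrier;
  atlas : set (chart R m mcarrier);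
  atlas_cover : forall p, exists2 c, atlas c & cdom c p;
  atlas_smooth : forall c d, atlas c -> atlas d -> forall i : 'I_m,
    smooth_on (cimg c `&` cinv c @^-1` cdom d)
      (fun u => cmap d (cinv c u) 0 i) }.

Section SmoothFunctions.
Context {R : realType} {m : nat} (M : manifold R m).

Definition smooth_fun (f : M -> R) : Prop :=
  forall c, atlas (m := m) c -> smooth_on (cimg c) (f \o cinv c).

Definition smooth_pred : {pred M -> R} := fun f => `[< smooth_fun f >].

Lemma smooth_cst (a : R) : smooth_fun (fun=> a).
Proof. by move=> c _ k; apply: Ck_cst; exact: cimg_open. Qed.

Lemma smooth_subring : subring_closed smooth_pred.
Proof.
have SD f h : smooth_fun f -> smooth_fun h -> smooth_fun (f + h).
  by move=> sf sh c ac k; apply: CkD;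
    [exact: cimg_open|exact: (sf c ac k)|exact: (sh c ac k)].
have SM f h : smooth_fun f -> smooth_fun h -> smooth_fun (f * h).
  by move=> sf sh c ac k; apply: CkM;
    [exact: cimg_open|exact: (sf c ac k)|exact: (sh c ac k)].
split; first by apply/asboolP; exact: smooth_cst.
  move=> f h /asboolP sf /asboolP sh; apply/asboolP.
  apply: SD => //; rewrite -mulN1r; apply: SM => //; exact: smooth_cst (-1).
by move=> f h /asboolP sf /asboolP sh; apply/asboolP; exact: SM.
Qed.

Record Cinfty := MkCinfty { sfun :> M -> R; sfunP : sfun \in smooth_pred }.

HB.instance Definition _ := [isSub for sfun].
HB.instance Definition _ := [Choice of Cinfty by <:].
HB.instance Definition _ :=
  GRing.SubChoice_isSubComPzRing.Build (M -> R) smooth_pred Cinfty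
    smooth_subring.

Definition csmooth (a : R) : Cinfty := MkCinfty (asboolT (smooth_cst a)).

End SmoothFunctions.

Notation "a %:S" := (csmooth _ a) (at level 1, format "a %:S") : ring_scope.

Section VectorFields.
Context {R : realType} {m : nat} (M : manifold R m).
Local Notation C := (Cinfty M).

Definition derivation (X : C -> C) : Prop :=
  [/\ forall f h, X (f + h) = X f + X h,
      forall (a : R) f, X (a%:S * f) = a%:S * X f
    & forall f h, X (f * h) = f * X h + h * X f].

Definition derivation_pred : {pred C -> C} := fun X => `[< derivation X >].

Lemma derivation_scale (k : C) X :
  derivation X -> derivation (fun f => k * X f).
Proof.
move=> [XD XZ XM]; split=> [f h|a f|f h].
- by rewrite XD mulrDr.
- by rewrite XZ mulrCA.
- by rewrite XM mulrDr; congr (_ + _); rewrite mulrCA.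
Qed.

Lemma derivation_zmod : zmod_closed derivation_pred.
Proof.
split; first by apply/asboolP; split=> *; rewrite /= ?addr0 ?mulr0 ?addr0.
move=> X Y /asboolP[XD XZ XM] /asboolP[YD YZ YM]; apply/asboolP.
split=> [f h|a f|f h].
- by rewrite -[LHS]/(X _ - Y _) XD YD opprD addrACA.
- by rewrite -[LHS]/(X _ - Y _) XZ YZ -mulrBr.
- by rewrite -[LHS]/(X _ - Y _) XM YM opprD addrACA -!mulrBr.
Qed.

(* Vector fields are the derivations of the algebra of smooth functions. *)
Record vfield :=
  MkVfield { vfun :> C -> C; vfunP : vfun \in derivation_pred }.

HB.instance Definition _ := [isSub for vfun].
HB.instance Definition _ := [Choice of vfield by <:].
HB.instance Definition _ :=
  GRing.SubChoice_isSubZmodule.Build (C -> C) derivation_pred vfield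
    derivation_zmod.

Lemma vfieldP (X : vfield) : derivation X.
Proof. exact/asboolP/vfunP. Qed.

Definition scale_vfield (k : C) (X : vfield) : vfield :=
  MkVfield (asboolT (derivation_scale k (vfieldP X))).

Lemma scale_vfieldA k l X :
  scale_vfield k (scale_vfield l X) = scale_vfield (k * l) X.
Proof. by apply/val_inj/funext => f; exact: mulrA. Qed.

Lemma scale_vfield1 : left_id 1 scale_vfield.
Proof. by move=> X; apply/val_inj/funext => f; exact: mul1r. Qed.

Lemma scale_vfieldDr : right_distributive scale_vfield +%R.
Proof. by move=> k X Y; apply/val_inj/funext => f; exact: mulrDr. Qed.

Lemma scale_vfieldDl X : {morph scale_vfield^~ X : k l / k + l}.
Proof. by move=> k l; apply/val_inj/funext => f; exact: mulrDl. Qed.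

HB.instance Definition _ := GRing.Zmodule_isLmodule.Build C vfield
  scale_vfieldA scale_vfield1 scale_vfieldDr scale_vfieldDl.

Lemma derivation_bracket (X Y : vfield) :
  derivation (fun f => X (Y f) - Y (X f)).
Proof.
have [XD XZ XM] := vfieldP X; have [YD YZ YM] := vfieldP Y.
split=> [f h|a f|f h].
- by rewrite YD XD XD YD opprD addrACA.
- by rewrite YZ XZ XZ YZ mulrBr.
- by rewrite YM XD !XM YD !YM; ring.
Qed.

Definition bracket (X Y : vfield) : vfield :=
  MkVfield (asboolT (derivation_bracket X Y)).

(* Tangent vectors at [p] are the derivations at [p]. *)
Definition tangent_vector (p : M) (v : C -> R) : Prop :=
  [/\ forall f h, v (f + h) = v f + v h,
      forall (a : R) f, v (a%:S * f) = a * v f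
    & forall f h, v (f * h) = f p * v h + h p * v f].

(* [e] is a basis of the tangent space at every point of [U].  Taking globally
   defined fields is no loss: after shrinking [U], any local frame extends to
   global fields by means of a bump function. *)
Definition local_frame (U : set M) (e : 'I_m -> vfield) : Prop :=
  forall p, U p -> forall v, tangent_vector p v ->
    exists! a : 'rV[R]_m, forall f, v f = \sum_(i < m) a 0 i * (e i f) p.

Definition linear_connection (D : vfield -> vfield -> vfield) : Prop :=
  [/\ forall (f : C) x x' y, D (f *: x + x') y = f *: D x y + D x' y,
      forall x y y', D x (y + y') = D x y + D x y'
    & forall (x : vfield) (f : C) y, D x (f *: y) = f *: D x y + x f *: y].

(* Tensor fields are encoded as [Cinfty M]-multilinear maps on vector fields.
   The last clause is nondegeneracy on each tangent space: a tangent vector at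
   [p] which is [g]-orthogonal to all tangent vectors at [p] vanishes. *)
Definition pseudo_riemannian (g : vfield -> vfield -> C) : Prop :=
  [/\ forall (f : C) x x' y, g (f *: x + x') y = f * g x y + g x' y,
      forall x y, g x y = g y x
    & forall (p : M) (x : vfield), (forall y, g x y p = 0) -> forall f, x f p = 0].

Definition levi_civita (g : vfield -> vfield -> C)
    (D : vfield -> vfield -> vfield) : Prop :=
  [/\ linear_connection D,
      forall x y, D x y - D y x = bracket x y
    & forall x y z : vfield, x (g y z) = g (D x y) z + g y (D x z)].

Definition almost_complex (J : {linear vfield -> vfield}) : Prop :=
  forall x, J (J x) = - x.

Definition norden (J : {linear vfield -> vfield})
    (g : vfield -> vfield -> C) : Prop :=
  forall x y, g (J x) (J y) = - g x y.

(* (D_x J) y *)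
Definition covJ (D : vfield -> vfield -> vfield)
    (J : {linear vfield -> vfield}) (x y : vfield) : vfield :=
  D x (J y) - J (D x y).

Definition complex_connection (J : {linear vfield -> vfield})
    (D : vfield -> vfield -> vfield) : Prop :=
  linear_connection D /\ forall x y, covJ D J x y = 0.

Definition Ften (J : {linear vfield -> vfield}) (g : vfield -> vfield -> C)
    (D : vfield -> vfield -> vfield) (x y z : vfield) : C :=
  g (covJ D J x y) z.

Definition lie_form (J : {linear vfield -> vfield})
    (g : vfield -> vfield -> C) (D : vfield -> vfield -> vfield)
    (theta : vfield -> C) : Prop :=
  forall (U : set M) (e : 'I_m -> vfield), open U -> local_frame U e ->
  forall p, U p -> forall x,
    theta x p = \sum_(i < m) \sum_(j < m)
      invmx (\matrix_(k < m, l < m) g (e k) (e l) p) i j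
      * Ften J g D (e i) (e j) x p.

Definition lie_vector (g : vfield -> vfield -> C) (theta : vfield -> C)
    (Omega : vfield) : Prop :=
  forall x, theta x = g x Omega.

End VectorFields.

Arguments vfield {R m} M.

Section W1.
Context {R : realType} {n : nat} {M : manifold R (2 * n)}.
Local Notation C := (Cinfty M).
Local Notation X := (vfield M).

Definition W1_manifold (J : {linear X -> X}) (g : X -> X -> C)
    (D : X -> X -> X) (theta : X -> C) : Prop :=
  forall x y z, Ften J g D x y z =
    ((2 * n)%:R^-1)%:S *
      (g x y * theta z + g x (J y) * theta (J z)
       + g x z * theta y + g x (J z) * theta (J y)).

Definition Qten (J : {linear X -> X}) (g : X -> X -> C) (theta : X -> C)
    (Omega : X) (l1 l2 l3 l4 l5 l6 l7 l8 : R) (x y : X) : X :=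
  ((2 * n)%:R^-1)%:S *: (theta (J y) *: x - g x y *: J Omega)
  + (n%:R^-1)%:S *:
    (l1%:S *: (theta x *: y) + l2%:S *: (theta x *: J y)
     + l3%:S *: (theta (J x) *: y) + l4%:S *: (theta (J x) *: J y)
     + l5%:S *: (theta y *: x - theta (J y) *: J x)
     + l6%:S *: (theta y *: J x + theta (J y) *: x)
     + l7%:S *: (g x y *: Omega - g x (J y) *: J Omega)
     + l8%:S *: (g x (J y) *: Omega + g x y *: J Omega)).

End W1.

(* Main.v *)
Require Import Defs.
From mathcomp Require Import all_boot all_order all_algebra.
From mathcomp Require Import all_classical all_reals all_analysis.
From mathcomp Require Import ring.

(** The Norden condition makes [J] self-adjoint for [g], so the [W1] condition
    determines [nabla J] explicitly by nondegeneracy: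
    [(nabla_x J) y
       = 1/2n (g(x,y) Omega + g(x,Jy) J Omega + theta(y) x + theta(Jy) J x)].
    The [1/2n] part of [Q] contributes exactly the opposite of this to
    [Q(x,Jy) - J Q(x,y)], while each [lambda_i] term commutes with [J] in [y]
    and contributes nothing. *)

Set Implicit Arguments.
Unset Strict Implicit.
Unset Printing Implicit Defensive.

Import Order.TTheory GRing.Theory Num.Theory.
Local Open Scope ring_scope.

Section VectorFieldCalculus.
Context {R : realType} {m : nat} {M : manifold R m}.
Local Notation C := (Cinfty M).
Local Notation X := (vfield M).

Lemma vfield_ext (x y : X) : (forall f, x f = y f) -> x = y.
Proof. by move=> xy; apply/val_inj/funext. Qed.

Lemma vfieldDE (x y : X) f : (x + y) f = x f + y f. Proof. by []. Qed.

Lemma vfieldNE (x : X) f : (- x) f = - x f. Proof. by []. Qed.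

Lemma vfieldZE (k : C) (x : X) f : (k *: x) f = k * x f. Proof. by []. Qed.

Definition vfieldE := (vfieldDE, vfieldNE, vfieldZE).

(** Connections form an affine space over the [C]-bilinear maps: linearity of [Q] over functions in
    [y] leaves the Leibniz term of [D] as the only derivative term. *)
Lemma linear_connectionD (D Q : X -> X -> X) :
  linear_connection D ->
  (forall (f : C) x x' y, Q (f *: x + x') y = f *: Q x y + Q x' y) ->
  (forall (f : C) x y y', Q x (f *: y + y') = f *: Q x y + Q x y') ->
  linear_connection (fun x y => D x y + Q x y).
Proof.
move=> [Dl DD DZ] Ql Qr; have QD x y y' : Q x (y + y') = Q x y + Q x y'.
  by have := Qr 1 x y y'; rewrite !scale1r.
have Q0 x : Q x 0 = 0 by apply: (addIr (Q x 0)); rewrite -QD !add0r.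
split=> [f x x' y|x y y'|x f y].
- by rewrite Dl Ql scalerDr addrACA.
- by rewrite DD QD addrACA.
- by have := Qr f x y 0; rewrite !addr0 Q0 addr0 DZ scalerDr addrAC => ->.
Qed.

Variable g : X -> X -> C.
Hypothesis hg : pseudo_riemannian g.

Lemma metricDl x y z : g (x + y) z = g x z + g y z.
Proof. by have [+ _ _] := hg => /(_ 1 x y z); rewrite scale1r mul1r. Qed.

Lemma metric0l z : g 0 z = 0.
Proof. by apply: (addIr (g 0 z)); rewrite -metricDl !add0r. Qed.

Lemma metricZl f x z : g (f *: x) z = f * g x z.
Proof. by have [+ _ _] := hg => /(_ f x 0 z); rewrite metric0l !addr0. Qed.

Lemma metricNl x z : g (- x) z = - g x z.
Proof. by rewrite -scaleN1r metricZl mulN1r. Qed.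

Lemma metricC x y : g x y = g y x. Proof. by have [_ + _] := hg; apply. Qed.

Lemma metricDr x y z : g z (x + y) = g z x + g z y.
Proof. by rewrite metricC metricDl !(metricC _ z). Qed.

Lemma metricZr f x z : g z (f *: x) = f * g z x.
Proof. by rewrite metricC metricZl metricC. Qed.

Lemma metricNr x z : g z (- x) = - g z x.
Proof. by rewrite metricC metricNl metricC. Qed.

Lemma metric_nondeg x y : (forall z, g x z = g y z) -> x = y.
Proof.
move=> gxy; apply/eqP; rewrite -subr_eq0; apply/eqP/vfield_ext => f.
apply/val_inj/funext => p; have [_ _ gnd] := hg.
apply: (gnd p (x - y) _ f) => z.
by rewrite metricDl metricNl gxy subrr.
Qed.

(** Apply the Norden identity to the pair [x], [J y] and use that [J] squares to minus the
    identity. *)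
Lemma norden_adjoint (J : {linear X -> X}) :
  almost_complex J -> norden J g -> forall x y, g (J x) y = g x (J y).
Proof.
move=> hJ hJg x y; apply: oppr_inj.
by rewrite -[RHS]hJg hJ metricNr.
Qed.

End VectorFieldCalculus.

Section LieVector.
Context {R : realType} {n : nat} {M : manifold R (2 * n)}.
Local Notation X := (vfield M).
Variables (J : {linear X -> X}) (g : X -> X -> Cinfty M).
Variables (theta : X -> Cinfty M) (Omega : X) (l1 l2 l3 l4 l5 l6 l7 l8 : R).
Local Notation Q := (Qten J g theta Omega l1 l2 l3 l4 l5 l6 l7 l8).
Hypotheses (hJ : almost_complex J) (hg : pseudo_riemannian g).
Hypotheses (hJg : norden J g) (hOmega : lie_vector g theta Omega).

Lemma W1_covJ (D : X -> X -> X) x y : W1_manifold J g D theta ->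
  covJ D J x y = ((2 * n)%:R^-1)%:S *:
    (g x y *: Omega + g x (J y) *: J Omega + theta y *: x
     + theta (J y) *: J x).
Proof.
move=> hW1; apply: (metric_nondeg hg) => z; rewrite -/(Ften J g D x y z) hW1.
rewrite (metricZl hg) !(metricDl hg) !(metricZl hg).
(* Adjointness moves [J] onto [z], so that pairing [J Omega] with [z] gives [theta (J z)]. *)
rewrite !(norden_adjoint hg hJ hJg) !(metricC hg Omega) -!hOmega.
by ring.
Qed.

Lemma Qten_linearl f x x' y :
  Q (f *: x + x') y = f *: Q x y + Q x' y.
Proof.
have JE := (linearD J, linearN J, linearZ_LR J).
(* Written as [g _ Omega], [theta] inherits its linearity from the metric. *)
rewrite /Qten !hOmega !JE.
rewrite !(metricDl hg) !(metricZl hg).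
(* Evaluation at [h] turns the module identity into one in the commutative ring [C]. *)
by apply: vfield_ext => h; rewrite !vfieldE; ring.
Qed.

Lemma Qten_linearr f x y y' :
  Q x (f *: y + y') = f *: Q x y + Q x y'.
Proof.
have JE := (linearD J, linearN J, linearZ_LR J).
rewrite /Qten !hOmega !JE.
rewrite !(metricDl hg) !(metricZl hg) !(metricDr hg) !(metricZr hg).
by apply: vfield_ext => h; rewrite !vfieldE; ring.
Qed.

(** Replacing [y] by [J y] and applying [J] have the same effect on the brackets: both send that of
    [l5] to that of [l6], and that of [l6] to minus that of [l5]; likewise for [l7] and [l8]. Only
    the first summand of [Q] survives. *)
Lemma Qten_J x y :
  Q x (J y) - J (Q x y) = - (((2 * n)%:R^-1)%:S *:
    (g x y *: Omega + g x (J y) *: J Omega + theta y *: x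
     + theta (J y) *: J x)).
Proof.
have JE := (linearD J, linearN J, linearZ_LR J).
rewrite /Qten !hOmega !JE !hJ.
rewrite !(metricNl hg) !(metricNr hg).
by apply: vfield_ext => h; rewrite !vfieldE; ring.
Qed.

End LieVector.

Theorem theorem3p1 (R : realType) (n : nat) (hn : (0 < n)%N)
  (M : manifold R (2 * n))
  (J : {linear vfield M -> vfield M})
  (g : vfield M -> vfield M -> Cinfty M)
  (nabla : vfield M -> vfield M -> vfield M)
  (theta : vfield M -> Cinfty M) (Omega : vfield M)
  (hJ : almost_complex J) (hg : pseudo_riemannian g) (hJg : norden J g)
  (hnabla : levi_civita g nabla)
  (htheta : lie_form J g nabla theta) (hOmega : lie_vector g theta Omega)
  (hW1 : W1_manifold J g nabla theta)
  (l1 l2 l3 l4 l5 l6 l7 l8 : R) :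
  complex_connection J
    (fun x y => nabla x y + Qten J g theta Omega l1 l2 l3 l4 l5 l6 l7 l8 x y).
Proof.
have [hD _ _] := hnabla; split=> [|x y].
  apply: linear_connectionD => // f *.
    exact: Qten_linearl.
  exact: Qten_linearr.
(* Regroup as the [nabla] derivative of [J] plus [Q x (J y) - J (Q x y)]. *)
rewrite /covJ linearD opprD addrACA Qten_J //.
by rewrite -(W1_covJ hJ hg hJg hOmega x y hW1) subrr.
Qed.
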